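(* Strong barbed equivalence is undecidable in HOcore with 2 hidden names: there is a set $H$ of two channel names such that there is no algorithm deciding, for arbitrary HOcore processes $P$ and $Q$, whether $P$ and $Q$ are strongly barbed equivalent with respect to $H$.
   Context: HOcore processes are given by $P,Q ::= a(x).P \mid \overline{a}\langle P\rangle \mid P \parallel Q \mid x \mid 0$, where $a,b,\dots$ are channel names and $x,y,\dots$ are process variables; $a(x).P$ binds $x$ in $P$; parallel composition is associative and commutative with unit $0$; $\mathrm{fn}(P)$ denotes the free channel names of $P$. The labelled transition system has labels $\tau$, $\overline{a}\langle P\rangle$ and $a(P)$, with rules: $\overline{a}\langle P\rangle \xrightarrow{\overline{a}\langle P\rangle} 0$; $a(x).Q \xrightarrow{a(P)} Q\{P/x\}$; if $P \xrightarrow{l} P'$ then $P\parallel Q \xrightarrow{l} P'\parallel Q$ (and symmetrically); if $P \xrightarrow{\overline{a}\langle R\rangle} P'$ and $Q \xrightarrow{a(R)} Q'$ then $P \parallel Q \xrightarrow{\tau} P'\parallel Q'$ (and symmetrically). For a finite set $H$ of names: $P$ has a strong observable action on $a$ (resp. on the coname $\overline{a}$) w.r.t. $H$, written $P \downarrow^H_a$ (resp. $P\downarrow^H_{\overline a}$), if $a \notin H$ and $P \xrightarrow{a(Q)} R$ (resp. $P \xrightarrow{\overline{a}\langle Q\rangle} R$) for some $Q,R$. A symmetric relation $\mathcal{R}$ on processes is a strong barbed bisimulation w.r.t. $H$ if $P \mathcal{R} Q$ implies: (1) for every name or coname $\mu$, $P\downarrow^H_\mu$ implies $Q \downarrow^H_\mu$;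 (2) for all $R$ with $\mathrm{fn}(R)\cap H = \emptyset$, $(P\parallel R)\,\mathcal{R}\,(Q \parallel R)$; (3) if $P\xrightarrow{\tau} P'$ then there is $Q'$ with $Q \xrightarrow{\tau} Q'$ and $P' \mathcal{R} Q'$. Strong barbed equivalence w.r.t. $H$ is the largest strong barbed bisimulation w.r.t. $H$. *)

(* Defs.v *)
From Stdlib Require Import Arith List.
Import ListNotations.

(* Channel names are natural numbers; process variables are de Bruijn
   indices: [Inp a P] binds index 0 in [P]. *)
Inductive proc : Type :=
| Nil : proc
| Var : nat -> proc
| Inp : nat -> proc -> proc
| Out : nat -> proc -> proc
| Par : proc -> proc -> proc.

Fixpoint lift (c : nat) (P : proc) : proc :=
  match P with
  | Nil => Nil
  | Var i => if i <? c then Var i else Var (S i)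
  | Inp a P => Inp a (lift (S c) P)
  | Out a P => Out a (lift c P)
  | Par P Q => Par (lift c P) (lift c Q)
  end.

Fixpoint liftn (n : nat) (P : proc) : proc :=
  match n with 0 => P | S n => lift 0 (liftn n P) end.

Fixpoint subst (k : nat) (Q : proc) (P : proc) : proc :=
  match P with
  | Nil => Nil
  | Var i => if i <? k then Var i
             else if i =? k then liftn k Q else Var (pred i)
  | Inp a P => Inp a (subst (S k) Q P)
  | Out a P => Out a (subst k Q P)
  | Par P1 P2 => Par (subst k Q P1) (subst k Q P2)
  end.

Fixpoint fn (P : proc) : list nat :=
  match P with
  | Nil => []
  | Var _ => []
  | Inp a P => a :: fn P
  | Out a P => a :: fn P
  | Par P Q => fn P ++ fn Q
  end.

Inductive label : Type :=
| Tau : label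
| LOut : nat -> proc -> label
| LIn : nat -> proc -> label.

Inductive step : proc -> label -> proc -> Prop :=
| st_out : forall a P, step (Out a P) (LOut a P) Nil
| st_inp : forall a Q P, step (Inp a Q) (LIn a P) (subst 0 P Q)
| st_parL : forall P Q l P', step P l P' -> step (Par P Q) l (Par P' Q)
| st_parR : forall P Q l Q', step Q l Q' -> step (Par P Q) l (Par P Q')
| st_comL : forall P Q P' Q' a R,
    step P (LOut a R) P' -> step Q (LIn a R) Q' -> step (Par P Q) Tau (Par P' Q')
| st_comR : forall P Q P' Q' a R,
    step P (LIn a R) P' -> step Q (LOut a R) Q' -> step (Par P Q) Tau (Par P' Q').

Definition barb (H : list nat) (P : proc) (a : nat) (co : bool) : Prop :=
  ~ In a H /\
  if co then exists Q R, step P (LOut a Q) R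
  else exists Q R, step P (LIn a Q) R.

Definition strong_barbed_bisim (H : list nat) (Rel : proc -> proc -> Prop) : Prop :=
  (forall P Q, Rel P Q -> Rel Q P) /\
  forall P Q, Rel P Q ->
    (forall a co, barb H P a co -> barb H Q a co) /\
    (forall R, (forall a, In a (fn R) -> ~ In a H) -> Rel (Par P R) (Par Q R)) /\
    (forall P', step P Tau P' -> exists Q', step Q Tau Q' /\ Rel P' Q').

Definition strong_barbed_equiv (H : list nat) (P Q : proc) : Prop :=
  exists Rel, strong_barbed_bisim H Rel /\ Rel P Q.

Inductive mu : Type :=
| MZero : mu
| MSucc : mu
| MProj : nat -> mu
| MComp : mu -> list mu -> mu
| MPrim : mu -> mu -> mu
| MMin : mu -> mu.

Inductive eval : mu -> list nat -> nat -> Prop :=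
| ev_zero : forall v, eval MZero v 0
| ev_succ : forall x v, eval MSucc (x :: v) (S x)
| ev_proj : forall i v, i < length v -> eval (MProj i) v (nth i v 0)
| ev_comp : forall f gs v ws y,
    evals gs v ws -> eval f ws y -> eval (MComp f gs) v y
| ev_prim0 : forall f g v y, eval f v y -> eval (MPrim f g) (0 :: v) y
| ev_primS : forall f g n v z y,
    eval (MPrim f g) (n :: v) z -> eval g (n :: z :: v) y ->
    eval (MPrim f g) (S n :: v) y
| ev_min : forall f v n,
    eval f (n :: v) 0 ->
    (forall m, m < n -> exists k, eval f (m :: v) (S k)) ->
    eval (MMin f) v n
with evals : list mu -> list nat -> list nat -> Prop :=
| evs_nil : forall v, evals [] v []
| evs_cons : forall g gs v w ws,
    eval g v w -> evals gs v ws -> evals (g :: gs) v (w :: ws).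

Definition pair (x y : nat) : nat := (x + y) * (x + y + 1) / 2 + y.

Fixpoint enc (P : proc) : nat :=
  match P with
  | Nil => 0
  | Var i => S (pair 0 i)
  | Inp a P => S (pair 1 (pair a (enc P)))
  | Out a P => S (pair 2 (pair a (enc P)))
  | Par P Q => S (pair 3 (pair (enc P) (enc Q)))
  end.

Definition decides_sbe (H : list nat) (M : mu) : Prop :=
  forall P Q,
    (strong_barbed_equiv H P Q -> eval M [enc P; enc Q] 1) /\
    (~ strong_barbed_equiv H P Q -> eval M [enc P; enc Q] 0).

(* Main.v *)
(* The two hidden names 0 and 1 suffice to run a call-by-name Krivine machine:
   the state "code M, stack N1 ... Nk" is M || 1<0<N1> || 1<0<N2> || 1<...>>>, and
   it has exactly one tau step.  Partial recursive functions are compiled to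
   closed lambda terms on Scott numerals in continuation-passing style, so a
   decider M yields a term that, on the numeral of its own code, builds the
   encodings of the two systems consisting of itself started on the stack bottoms
   2<0> and 0, asks M whether they are equivalent, and releases its stack bottom
   if the answer is 1 but gets stuck if it is 0.  The runs of the two systems are
   deterministic and differ only in the bottom, so they are equivalent exactly
   when M answers that they are not. *)
Require Import Defs.
From Stdlib Require Import Arith Lia List Permutation.
Import ListNotations.

(** * Lists of processes as multisets *)

Lemma proc_eq_dec (P Q : proc) : {P = Q} + {P <> Q}.
Proof. decide equality; apply Nat.eq_dec. Defined.

Definition mult (L : list proc) (x : proc) : nat := count_occ proc_eq_dec L x.

Lemma mult_cons y L x :
  mult (y :: L) x = (if proc_eq_dec y x then 1 else 0) + mult L x.
Proof. unfold mult; simpl; destruct proc_eq_dec; reflexivity. Qed.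

Lemma mult_app L K x : mult (L ++ K) x = mult L x + mult K x.
Proof. apply count_occ_app. Qed.

Lemma perm_mult L K : Permutation L K <-> forall x, mult L x = mult K x.
Proof. apply Permutation_count_occ. Qed.

(** Permutations become equations between multiplicities of an arbitrary element, which linear
    arithmetic settles. *)
Ltac perm :=
  repeat match goal with
  | H : Permutation _ _ |- _ => rewrite perm_mult in H
  end;
  rewrite perm_mult;
  let x := fresh "x" in
  intro x;
  repeat match goal with
  | H : forall x, mult _ x = mult _ x |- _ => specialize (H x)
  end;
  repeat rewrite ?mult_cons, ?mult_app in *;
  try (change (mult [] x) with 0 in * );
  lia.

Lemma in_perm (x : proc) L : In x L -> exists K, Permutation L (x :: K).
Proof.
  intros Hx. destruct (in_split _ _ Hx) as (l1 & l2 & ->). exists (l1 ++ l2). perm.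
Qed.

(** * Transitions up to structural congruence *)

(** The components, taken up to permutation, stand for a process modulo the monoid laws of top-level
    parallel composition, which the raw syntax does not quotient by. *)
Fixpoint flat (P : proc) : list proc :=
  match P with
  | Nil => []
  | Par P Q => flat P ++ flat Q
  | _ => [P]
  end.

Definition ltau (L L' : list proc) : Prop :=
  exists n R B K,
    Permutation L (Out n R :: Inp n B :: K) /\
    Permutation L' (flat (subst 0 R B) ++ K).

Lemma step_flat P l P' :
  step P l P' ->
  match l with
  | Tau => ltau (flat P) (flat P')
  | LOut n R => Permutation (flat P) (Out n R :: flat P')
  | LIn n R => exists B K, Permutation (flat P) (Inp n B :: K) /\
                           Permutation (flat P') (flat (subst 0 R B) ++ K)
  end.
Proof.
  induction 1; simpl.
  - reflexivity.
  - exists Q, []. rewrite app_nil_r. auto.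
  - destruct l as [|n R|n R].
    + destruct IHstep as (n & R & B & K & H1 & H2). exists n, R, B, (K ++ flat Q).
      split; perm.
    + perm.
    + destruct IHstep as (B & K & H1 & H2). exists B, (K ++ flat Q). split; perm.
  - destruct l as [|n R|n R].
    + destruct IHstep as (n & R & B & K & H1 & H2). exists n, R, B, (K ++ flat P).
      split; perm.
    + perm.
    + destruct IHstep as (B & K & H1 & H2). exists B, (K ++ flat P). split; perm.
  - destruct IHstep2 as (B & K & H1 & H2). exists a, R, B, (flat P' ++ K).
    split; perm.
  - destruct IHstep1 as (B & K & H1 & H2). exists a, R, B, (flat Q' ++ K).
    split; perm.
Qed.

Lemma out_step P n R :
  In (Out n R) (flat P) -> exists P', step P (LOut n R) P'.
Proof.
  induction P; simpl; try (intros [E|[]]; try discriminate E; fail); try tauto.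
  - intros [E|[]]. injection E as -> ->. eexists. constructor.
  - rewrite in_app_iff. intros [H|H].
    + destruct (IHP1 H). eexists. apply st_parL; eauto.
    + destruct (IHP2 H). eexists. apply st_parR; eauto.
Qed.

Lemma in_step P n B R :
  In (Inp n B) (flat P) ->
  exists P' K, step P (LIn n R) P' /\ Permutation (flat P) (Inp n B :: K) /\
               Permutation (flat P') (flat (subst 0 R B) ++ K).
Proof.
  induction P; simpl; try (intros [E|[]]; try discriminate E; fail); try tauto.
  - intros [E|[]]. injection E as -> ->. exists (subst 0 R B), [].
    rewrite app_nil_r. repeat split; auto. constructor.
  - rewrite in_app_iff. intros [H|H].
    + destruct (IHP1 H) as (P' & K & H1 & H2 & H3).
      exists (Par P' P2), (K ++ flat P2). repeat split.
      * apply st_parL; auto.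
      * perm.
      * simpl; perm.
    + destruct (IHP2 H) as (P' & K & H1 & H2 & H3).
      exists (Par P1 P'), (K ++ flat P1). repeat split.
      * apply st_parR; auto.
      * perm.
      * simpl; perm.
Qed.

(** Induction on where the two partners sit. On the same side the step lifts through the
    composition; on opposite sides an output transition and an input transition synchronise. *)
Lemma com_step P n R B :
  In (Out n R) (flat P) -> In (Inp n B) (flat P) ->
  exists P' K, step P Tau P' /\ Permutation (flat P) (Out n R :: Inp n B :: K) /\
               Permutation (flat P') (flat (subst 0 R B) ++ K).
Proof.
  induction P; simpl; try tauto;
    try (intros [E|[]] [E'|[]]; congruence).
  rewrite !in_app_iff. intros [H|H] [H'|H'].
  - destruct (IHP1 H H') as (P' & K & H1 & H2 & H3).
    exists (Par P' P2), (K ++ flat P2). repeat split.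
    + apply st_parL; auto.
    + perm.
    + simpl; perm.
  - destruct (out_step _ _ _ H) as (P' & H1).
    destruct (in_step _ _ _ R H') as (P'' & K & H2 & H3 & H4).
    pose proof (step_flat _ _ _ H1) as H5. simpl in H5.
    exists (Par P' P''), (K ++ flat P'). repeat split.
    + eapply st_comL; eauto.
    + perm.
    + simpl; perm.
  - destruct (out_step _ _ _ H) as (P' & H1).
    destruct (in_step _ _ _ R H') as (P'' & K & H2 & H3 & H4).
    pose proof (step_flat _ _ _ H1) as H5. simpl in H5.
    exists (Par P'' P'), (K ++ flat P'). repeat split.
    + eapply st_comR; eauto.
    + perm.
    + simpl; perm.
  - destruct (IHP2 H H') as (P' & K & H1 & H2 & H3).
    exists (Par P1 P'), (K ++ flat P1). repeat split.
    + apply st_parR; auto.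
    + perm.
    + simpl; perm.
Qed.

Lemma ltau_step P L :
  ltau (flat P) L -> exists P', step P Tau P' /\ Permutation (flat P') L.
Proof.
  intros (n & R & B & K & H1 & H2).
  destruct (com_step P n R B) as (P' & K' & H3 & H4 & H5).
  - rewrite H1; simpl; auto.
  - rewrite H1; simpl; auto.
  - exists P'. split; auto. perm.
Qed.

Lemma ltau_perm L L' K : Permutation L L' -> ltau L K -> ltau L' K.
Proof.
  intros H (n & R & B & M & H1 & H2). exists n, R, B, M. split; perm.
Qed.

(** * Deterministic hidden systems in a context *)

Definition head_in (H : list nat) (P : proc) : Prop :=
  match P with
  | Inp n _ | Out n _ => In n H
  | _ => False
  end.

Definition hidden (H : list nat) (L : list proc) : Prop :=
  forall P, In P L -> head_in H P.

Definition avoids (H : list nat) (L : list proc) : Prop :=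
  forall P n, In P L -> In n (fn P) -> ~ In n H.

Lemma in_fn_lift n c P : In n (fn (lift c P)) -> In n (fn P).
Proof.
  revert c; induction P; intros c; simpl; auto.
  - destruct (_ <? _); auto.
  - intros [H|H]; eauto.
  - intros [H|H]; eauto.
  - rewrite !in_app_iff. intros [H|H]; eauto.
Qed.

Lemma in_fn_liftn n k P : In n (fn (liftn k P)) -> In n (fn P).
Proof. induction k; simpl; auto. intros H. eauto using in_fn_lift. Qed.

Lemma in_fn_subst n k Q P :
  In n (fn (subst k Q P)) -> In n (fn Q) \/ In n (fn P).
Proof.
  revert k; induction P; intros k; simpl; auto.
  - destruct (_ <? _); auto. destruct (_ =? _); auto. eauto using in_fn_liftn.
  - intros [H|H]; auto. apply IHP in H. tauto.
  - intros [H|H]; auto. apply IHP in H. tauto.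
  - rewrite !in_app_iff. intros [H|H]; [apply IHP1 in H | apply IHP2 in H]; tauto.
Qed.

Lemma in_fn_flat n P Q : In Q (flat P) -> In n (fn Q) -> In n (fn P).
Proof.
  induction P; simpl; try (intros [<-|[]]; auto; fail); try tauto.
  rewrite !in_app_iff. tauto.
Qed.

Lemma ltau_avoids H L L' : avoids H L -> ltau L L' -> avoids H L'.
Proof.
  intros HL (n & R & B & K & H1 & H2) P m HP Hm.
  assert (HO : forall x, In x (Out n R :: Inp n B :: K) -> In m (fn x) -> ~ In m H).
  { intros x Hx. apply HL. rewrite H1. exact Hx. }
  rewrite H2, in_app_iff in HP. destruct HP as [HP|HP].
  - destruct (in_fn_subst _ _ _ _ (in_fn_flat _ _ _ HP Hm)).
    + apply (HO (Out n R)); simpl; auto.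
    + apply (HO (Inp n B)); simpl; auto.
  - apply (HO P); simpl; auto.
Qed.

(** Partners on opposite sides would share a channel that is in [H] for the hidden side and outside
    [H] for the context. *)
Lemma ltau_split H L E L' :
  hidden H L -> avoids H E -> ltau (L ++ E) L' ->
  (exists L1, ltau L L1 /\ Permutation L' (L1 ++ E)) \/
  (exists E1, ltau E E1 /\ Permutation L' (L ++ E1)).
Proof.
  intros HL HE (n & R & B & K & H1 & H2).
  assert (HO : In (Out n R) (L ++ E)) by (rewrite H1; simpl; auto).
  assert (HI : In (Inp n B) (L ++ E)) by (rewrite H1; simpl; auto).
  rewrite in_app_iff in HO, HI. destruct HO as [HO|HO], HI as [HI|HI].
  - left. destruct (in_perm _ _ HO) as (K1 & H3).
    rewrite H3 in HI. destruct HI as [HI|HI]; [discriminate|].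
    destruct (in_perm _ _ HI) as (K2 & H4).
    exists (flat (subst 0 R B) ++ K2). split; [exists n, R, B, K2; split|]; perm.
  - exfalso. apply (HE _ n HI); simpl; auto. apply (HL _ HO).
  - exfalso. apply (HE _ n HO); simpl; auto. apply (HL _ HI).
  - right. destruct (in_perm _ _ HO) as (K1 & H3).
    rewrite H3 in HI. destruct HI as [HI|HI]; [discriminate|].
    destruct (in_perm _ _ HI) as (K2 & H4).
    exists (flat (subst 0 R B) ++ K2). split; [exists n, R, B, K2; split|]; perm.
Qed.

Lemma ltau_app_l L L' E : ltau L L' -> ltau (L ++ E) (L' ++ E).
Proof.
  intros (n & R & B & K & H1 & H2). exists n, R, B, (K ++ E). split; perm.
Qed.

Lemma ltau_app_r L E E' : ltau E E' -> ltau (L ++ E) (L ++ E').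
Proof.
  intros (n & R & B & K & H1 & H2). exists n, R, B, (L ++ K). split; perm.
Qed.

Definition det (L L' : list proc) : Prop :=
  ltau L L' /\ forall L'', ltau L L'' -> Permutation L'' L'.

Definition stuck (L : list proc) : Prop := forall L', ~ ltau L L'.

(* Hidden components cannot synchronise with a context that avoids [H], so two
   deterministic hidden systems are equivalent as soon as they run for the same
   number of steps. *)
Inductive lockstep (H : list nat) : list proc -> list proc -> Prop :=
| lock_stuck L1 L2 :
    hidden H L1 -> hidden H L2 -> stuck L1 -> stuck L2 -> lockstep H L1 L2
| lock_step L1 L2 L1' L2' :
    hidden H L1 -> hidden H L2 -> det L1 L1' -> det L2 L2' ->
    lockstep H L1' L2' -> lockstep H L1 L2.

Lemma lockstep_sym H L1 L2 : lockstep H L1 L2 -> lockstep H L2 L1.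
Proof. induction 1; [apply lock_stuck | eapply lock_step]; eauto. Qed.

Lemma lockstep_hidden H L1 L2 : lockstep H L1 L2 -> hidden H L1.
Proof. destruct 1; auto. Qed.

Lemma lockstep_equiv H P Q :
  lockstep H (flat P) (flat Q) -> strong_barbed_equiv H P Q.
Proof.
  intros HPQ.
  (* The candidate relation puts systems in lockstep beside a common context [E] that avoids [H].
     Visible barbs come from [E] alone, a new parallel process joins [E], and a tau step belongs
     either to the hidden system or to [E]. *)
  exists (fun P Q => exists L1 L2 E, lockstep H L1 L2 /\ avoids H E /\
            Permutation (flat P) (L1 ++ E) /\ Permutation (flat Q) (L2 ++ E)).
  split.
  2:{ exists (flat P), (flat Q), []. rewrite !app_nil_r.
      repeat split; auto. intros x n []. }
  clear P Q HPQ. split.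
  { intros P Q (L1 & L2 & E & H1 & H2 & H3 & H4).
    exists L2, L1, E. auto using lockstep_sym. }
  intros P Q (L1 & L2 & E & HL & HE & HP & HQ). repeat split.
  - apply H0.
  - destruct H0 as [Hn Hs]. destruct co.
    + destruct Hs as (R & P' & Hs). apply step_flat in Hs.
      assert (HO : In (Out a R) (L1 ++ E)) by (rewrite <- HP, Hs; simpl; auto).
      rewrite in_app_iff in HO. destruct HO as [HO|HO].
      * apply (lockstep_hidden _ _ _ HL) in HO. contradiction.
      * destruct (out_step Q a R) as (Q' & HQ').
        { rewrite HQ, in_app_iff. auto. }
        eauto.
    + destruct Hs as (R & P' & Hs). apply step_flat in Hs.
      destruct Hs as (B & K & Hs & _).
      assert (HO : In (Inp a B) (L1 ++ E)) by (rewrite <- HP, Hs; simpl; auto).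
      rewrite in_app_iff in HO. destruct HO as [HO|HO].
      * apply (lockstep_hidden _ _ _ HL) in HO. contradiction.
      * destruct (in_step Q a B R) as (Q' & _ & HQ' & _).
        { rewrite HQ, in_app_iff. auto. }
        eauto.
  - intros R HR. exists L1, L2, (E ++ flat R). simpl. repeat split; auto.
    + intros x n. rewrite in_app_iff. intros [Hx|Hx] Hn.
      * eapply HE; eauto.
      * eapply HR, in_fn_flat; eauto.
    + perm.
    + perm.
  - intros P' Hs. apply step_flat in Hs. simpl in Hs.
    apply (ltau_perm _ _ _ HP) in Hs.
    destruct (ltau_split _ _ _ _ (lockstep_hidden _ _ _ HL) HE Hs)
      as [(L1' & Ht & HP')|(E' & Ht & HP')].
    + destruct HL as [L1 L2 _ _ Hst _|L1 L2 L1'' L2'' _ _ Hd1 Hd2 HL].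
      * destruct (Hst _ Ht).
      * apply Hd1 in Ht.
        destruct (ltau_step Q (L2'' ++ E)) as (Q' & HQ1 & HQ2).
        { apply (ltau_perm (L2 ++ E)); [perm|]. apply ltau_app_l, Hd2. }
        exists Q'. split; auto. exists L1'', L2'', E. repeat split; auto. perm.
    + destruct (ltau_step Q (L2 ++ E')) as (Q' & HQ1 & HQ2).
      { apply (ltau_perm (L2 ++ E)); [perm|]. apply ltau_app_r, Ht. }
      exists Q'. split; auto. exists L1, L2, E'.
      repeat split; eauto using ltau_avoids.
Qed.

(** The only input is the one on [n], and the other components are outputs on other channels, so no
    second pair can communicate. *)
Lemma det_com n R B K :
  (forall x, In x K -> exists m S, x = Out m S /\ m <> n) ->
  det (Out n R :: Inp n B :: K) (flat (subst 0 R B) ++ K).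
Proof.
  intros HK. split.
  { exists n, R, B, K. auto. }
  intros L' (m & R' & B' & K' & H1 & H2).
  assert (HI : In (Inp m B') (Out n R :: Inp n B :: K)) by (rewrite H1; simpl; auto).
  assert (HO : In (Out m R') (Out n R :: Inp n B :: K)) by (rewrite H1; simpl; auto).
  destruct HI as [HI|[HI|HI]]; [discriminate | |
    apply HK in HI; destruct HI as (? & ? & HI & _); discriminate].
  injection HI as <- <-.
  destruct HO as [HO|[HO|HO]]; [ | discriminate |
    apply HK in HO; destruct HO as (? & ? & HO & HO'); congruence].
  injection HO as <-. perm.
Qed.

Lemma det_perm L K L' : Permutation L K -> det L L' -> det K L'.
Proof.
  intros H [H1 H2]. split.
  - eapply ltau_perm; eauto.
  - intros L'' HL. apply H2. eapply ltau_perm; [symmetry|]; eauto.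
Qed.

(** Determinism of [Q] leaves its answer no choice, so any bisimulation must relate the two
    successors. *)
Lemma bisim_det Rel H P Q L1 L2 :
  strong_barbed_bisim H Rel -> Rel P Q ->
  det (flat P) L1 -> det (flat Q) L2 ->
  exists P' Q', Rel P' Q' /\ Permutation (flat P') L1 /\ Permutation (flat Q') L2.
Proof.
  intros [_ HB] HR [Ht1 _] [_ Hd2].
  destruct (ltau_step _ _ Ht1) as (P' & HP' & HL).
  destruct (proj2 (proj2 (HB _ _ HR)) _ HP') as (Q' & HQ' & HR').
  exists P', Q'. repeat split; auto. apply Hd2. exact (step_flat _ _ _ HQ').
Qed.

(** * The Krivine machine *)

Fixpoint cl (k : nat) (P : proc) : Prop :=
  match P with
  | Nil => True
  | Var i => i < k
  | Inp _ P => cl (S k) P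
  | Out _ P => cl k P
  | Par P Q => cl k P /\ cl k Q
  end.

Ltac ltb_cases :=
  repeat match goal with
  | |- context [?i <? ?k] => destruct (Nat.ltb_spec i k); cbn [subst lift cl pred]; try lia
  | |- context [?i =? ?k] => destruct (Nat.eqb_spec i k); cbn [subst lift cl pred]; try lia
  end.

Lemma cl_mono j k P : cl j P -> j <= k -> cl k P.
Proof.
  revert j k; induction P; simpl; intros j k H Hjk; auto; try lia.
  - eapply IHP; eauto; lia.
  - eauto.
  - destruct H; eauto.
Qed.

Lemma lift_cl k c P : cl k P -> k <= c -> lift c P = P.
Proof.
  revert k c; induction P; simpl; intros k c H Hk; auto.
  - ltb_cases. reflexivity.
  - f_equal. eapply IHP; eauto; lia.
  - f_equal. eauto.
  - destruct H. f_equal; eauto.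
Qed.

Lemma liftn_cl n P : cl 0 P -> liftn n P = P.
Proof.
  intros H. induction n; simpl; auto. rewrite IHn. eapply lift_cl; eauto.
Qed.

Lemma subst_cl k c N P : cl k P -> k <= c -> subst c N P = P.
Proof.
  revert k c; induction P; simpl; intros k c H Hk; auto.
  - ltb_cases. reflexivity.
  - f_equal. eapply IHP; eauto; lia.
  - f_equal. eauto.
  - destruct H. f_equal; eauto.
Qed.

Lemma cl_lift k c P : cl k P -> cl (S k) (lift c P).
Proof.
  revert k c; induction P; simpl; intros k c H; auto.
  - ltb_cases; lia.
  - destruct H; auto.
Qed.

Lemma subst_lift k Q P : subst k Q (lift k P) = P.
Proof.
  revert k; induction P; simpl; intros k; auto; try (f_equal; auto; fail).
  ltb_cases; reflexivity.
Qed.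

(** Lets substitution of closed terms pass through [lam] and [app], whose bodies are lifted; [N]
    itself is closed and unaffected by lifting. *)
Lemma subst_lift_comm k c N P :
  cl 0 N -> c <= k -> subst (S k) N (lift c P) = lift c (subst k N P).
Proof.
  intros HN. revert k c; induction P; simpl; intros k c H; auto.
  - destruct n as [|n]; ltb_cases; try reflexivity;
      rewrite ?liftn_cl by auto; try (erewrite lift_cl by (eauto; lia); reflexivity);
      try reflexivity; f_equal; lia.
  - f_equal. apply IHP. lia.
  - f_equal. auto.
  - f_equal; auto.
Qed.

(* A term first receives on name 1 the whole stack s, itself a process.  An
   abstraction runs s, which exposes the top of the stack on name 0 and the rest
   on name 1; an application sends a stack with one more element.  The lifts skip
   the binder of s. *)
Definition lam (M : proc) : proc := Inp 1 (Par (Var 0) (Inp 0 (lift 1 M))).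

Definition app (M N : proc) : proc :=
  Inp 1 (Par (lift 0 M) (Out 1 (Par (Out 0 (lift 0 N)) (Out 1 (Var 0))))).

Fixpoint stack (s : list proc) (bottom : proc) : proc :=
  match s with
  | [] => bottom
  | N :: s => Par (Out 0 N) (Out 1 (stack s bottom))
  end.

Definition conf (M : proc) (s : list proc) (bottom : proc) : list proc :=
  flat M ++ [Out 1 (stack s bottom)].

(** The received stack replaces exactly the binder that the lifts skip, so [subst_lift] cancels
    them. *)
Lemma det_app M N s bot : det (conf (app M N) s bot) (conf M (N :: s) bot).
Proof.
  pose proof (det_com 1 (stack s bot)
    (Par (lift 0 M) (Out 1 (Par (Out 0 (lift 0 N)) (Out 1 (Var 0))))) []) as D.
  cbn [subst Nat.ltb Nat.leb Nat.eqb liftn flat] in D.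
  rewrite !subst_lift, app_nil_r in D.
  apply (det_perm _ (conf (app M N) s bot)) in D; [exact D | | intros x []].
  apply perm_swap.
Qed.

Lemma det_lam M N s bot :
  det (conf (lam M) (N :: s) bot)
      [Out 0 N; Out 1 (stack s bot); Inp 0 M].
Proof.
  pose proof (det_com 1 (stack (N :: s) bot) (Par (Var 0) (Inp 0 (lift 1 M))) []) as D.
  cbn [subst Nat.ltb Nat.leb Nat.eqb liftn flat stack] in D.
  rewrite !subst_lift, app_nil_r in D.
  apply (det_perm _ (conf (lam M) (N :: s) bot)) in D; [exact D | | intros x []].
  apply perm_swap.
Qed.

Lemma det_beta M N s bot :
  det [Out 0 N; Out 1 (stack s bot); Inp 0 M] (conf (subst 0 N M) s bot).
Proof.
  pose proof (det_com 0 N M [Out 1 (stack s bot)]) as D.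
  eapply det_perm; [|apply D].
  - apply perm_skip, perm_swap.
  - intros x [<-|[]]. eauto.
Qed.

(* [reds M' s' M s]: the machine goes from code [M] and stack [s] to [M'] and [s']. *)
Inductive reds (M' : proc) (s' : list proc) : proc -> list proc -> Prop :=
| reds_refl : reds M' s' M' s'
| reds_app M N s : reds M' s' M (N :: s) -> reds M' s' (app M N) s
| reds_lam M N s : reds M' s' (subst 0 N M) s -> reds M' s' (lam M) (N :: s).

Lemma reds_trans M s M' s' M'' s'' :
  reds M' s' M s -> reds M'' s'' M' s' -> reds M'' s'' M s.
Proof. induction 1; auto using reds. Qed.

(** In [reds] an abstraction fires only on a nonempty stack, so the bottom stays inside a message:
    both systems make the same moves, with all components headed by 0 or 1. *)
Lemma lockstep_reds M s M' s' b1 b2 :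
  reds M' s' M s ->
  lockstep [0; 1] (conf M' s' b1) (conf M' s' b2) ->
  lockstep [0; 1] (conf M s b1) (conf M s b2).
Proof.
  intros HR HL. induction HR; auto.
  - eapply lock_step; [ | | apply det_app | apply det_app | exact IHHR];
      intros x [<-|[<-|[]]]; simpl; auto.
  - eapply lock_step; [ | | apply det_lam | apply det_lam | ].
    1,2: intros x [<-|[<-|[]]]; simpl; auto.
    eapply lock_step; [ | | apply det_beta | apply det_beta | exact IHHR];
      intros x [<-|[<-|[<-|[]]]]; simpl; auto.
Qed.

Lemma bisim_reds Rel H M s M' s' b1 b2 P Q :
  strong_barbed_bisim H Rel -> reds M' s' M s -> Rel P Q ->
  Permutation (flat P) (conf M s b1) -> Permutation (flat Q) (conf M s b2) ->
  exists P' Q', Rel P' Q' /\ Permutation (flat P') (conf M' s' b1) /\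
                Permutation (flat Q') (conf M' s' b2).
Proof.
  intros HB HR. revert P Q. induction HR; intros P Q HPQ HP HQ.
  - eauto.
  - destruct (bisim_det _ _ P Q _ _ HB HPQ
                (det_perm _ _ _ (Permutation_sym HP) (det_app _ _ _ _))
                (det_perm _ _ _ (Permutation_sym HQ) (det_app _ _ _ _)))
      as (P' & Q' & HPQ' & HP' & HQ'). eauto.
  - destruct (bisim_det _ _ P Q _ _ HB HPQ
                (det_perm _ _ _ (Permutation_sym HP) (det_lam _ _ _ _))
                (det_perm _ _ _ (Permutation_sym HQ) (det_lam _ _ _ _)))
      as (P' & Q' & HPQ' & HP' & HQ').
    destruct (bisim_det _ _ P' Q' _ _ HB HPQ'
                (det_perm _ _ _ (Permutation_sym HP') (det_beta _ _ _ _))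
                (det_perm _ _ _ (Permutation_sym HQ') (det_beta _ _ _ _)))
      as (P'' & Q'' & HPQ'' & HP'' & HQ''). eauto.
Qed.

(** * Substitution of closed terms into lambda terms *)

Lemma subst_lam k N M : cl 0 N -> subst k N (lam M) = lam (subst (S k) N M).
Proof.
  intros HN. unfold lam. simpl. rewrite (subst_lift_comm (S k) 1); auto. lia.
Qed.

Lemma subst_app k N M L :
  cl 0 N -> subst k N (app M L) = app (subst k N M) (subst k N L).
Proof.
  intros HN. unfold app. simpl. rewrite !subst_lift_comm; auto; lia.
Qed.

Lemma subst_var k N i :
  cl 0 N ->
  subst k N (Var i) = if i <? k then Var i else if i =? k then N else Var (pred i).
Proof. intros HN. simpl. rewrite liftn_cl; auto. Qed.

Lemma subst_cl0 k N P : cl 0 P -> subst k N P = P.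
Proof. intros H. eapply subst_cl; eauto. lia. Qed.

Lemma cl_lam k M : cl (S k) M -> cl k (lam M).
Proof. intros H. simpl. split; [lia|]. apply cl_lift. exact H. Qed.

Lemma cl_app k M N : cl k M -> cl k N -> cl k (app M N).
Proof. intros H1 H2. simpl. repeat split; auto using cl_lift. lia. Qed.

Lemma cl_0 k P : cl 0 P -> cl k P.
Proof. intros H. eapply cl_mono; eauto. lia. Qed.

Lemma cl_var k i : i < k -> cl k (Var i).
Proof. auto. Qed.

Opaque lam app.

(** * Compiling partial recursive functions *)

(* Scott numerals: n Z S reduces to Z if n = 0 and to S (n - 1) otherwise. *)
Fixpoint num (n : nat) : proc :=
  match n with
  | 0 => lam (lam (Var 1))
  | S n => lam (lam (app (Var 0) (num n)))
  end.

(** Nested pairs, each applying its argument to head and tail; the empty vector is the inert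
    [Nil]. *)
Fixpoint vec (v : list nat) : proc :=
  match v with
  | [] => Nil
  | x :: v => lam (app (app (Var 0) (num x)) (vec v))
  end.

Create HintDb clo.
Ltac clt :=
  repeat match goal with
  | |- cl _ (lam _) => apply cl_lam
  | |- cl _ (app _ _) => apply cl_app
  | |- cl _ (Var _) => apply cl_var; lia
  | |- True => exact I
  | |- cl _ _ => first [assumption | exact I | solve [apply cl_0; auto with clo nocore]]
  end.

Lemma cl_num n : cl 0 (num n).
Proof. induction n; simpl; clt. Qed.
Hint Resolve cl_num : clo.

Lemma cl_vec v : cl 0 (vec v).
Proof. induction v; simpl; clt. Qed.
Hint Resolve cl_vec : clo.

Ltac ssimpl :=
  repeat match goal with
  | |- context [subst ?k ?N (lam ?M)] => rewrite (subst_lam k N M) by clt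
  | |- context [subst ?k ?N (app ?M ?L)] => rewrite (subst_app k N M L) by clt
  | |- context [subst ?k ?N (Var ?i)] =>
      rewrite (subst_var k N i) by clt; cbn [Nat.ltb Nat.leb Nat.eqb pred]
  | |- context [subst ?k ?N ?P] => rewrite (subst_cl0 k N P) by clt
  end.

Ltac run :=
  repeat match goal with
  | |- reds _ _ (app _ _) _ => apply reds_app
  | |- reds _ _ (lam _) _ => apply reds_lam; ssimpl
  end.

(* Programs expect an argument vector and a continuation, which receives the
   value in normal form. *)
Definition succ_prog : proc :=
  lam (lam (app (Var 1) (lam (lam (app (Var 2) (lam (lam (app (Var 0) (Var 3))))))))).

Fixpoint proj_prog (i : nat) : proc :=
  match i with
  | 0 => lam (lam (app (Var 1) (lam (lam (app (Var 2) (Var 1))))))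
  | S i => lam (lam (app (Var 1) (lam (lam (app (app (proj_prog i) (Var 0)) (Var 2))))))
  end.

Fixpoint vec_prog (ts : list proc) : proc :=
  match ts with
  | [] => lam (lam (app (Var 0) Nil))
  | t :: ts =>
      lam (lam (app (app t (Var 1))
        (lam (app (app (vec_prog ts) (Var 2))
          (lam (app (Var 2) (lam (app (app (Var 0) (Var 2)) (Var 1)))))))))
  end.

Definition comp_prog (f g : proc) : proc :=
  lam (lam (app (app g (Var 1)) (lam (app (app f (Var 0)) (Var 1))))).

(* The loops receive themselves as their first argument, then the counter, the
   remaining arguments and the continuation. *)
Definition prim_loop (f g : proc) : proc :=
  lam (lam (lam (lam
    (app (app (Var 2) (app (app f (Var 1)) (Var 0)))
      (lam (app (app (app (app (Var 4) (Var 4)) (Var 0)) (Var 2))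
        (lam (app (app g
          (lam (app (app (Var 0) (Var 2)) (lam (app (app (Var 0) (Var 2)) (Var 5))))))
          (Var 2))))))))).

Definition prim_prog (f g : proc) : proc :=
  lam (lam (app (Var 1) (lam (lam
    (app (app (app (app (prim_loop f g) (prim_loop f g)) (Var 1)) (Var 0)) (Var 2)))))).

(** The value of [f] at the counter is a Scott numeral and so branches by itself: on 0 the counter
    goes to the continuation, otherwise the loop restarts on [lam (lam (app (Var 0) (Var 6)))], the
    successor of the counter. *)
Definition min_loop (f : proc) : proc :=
  lam (lam (lam (lam
    (app (app f (lam (app (app (Var 0) (Var 3)) (Var 2))))
      (lam (app (app (Var 0) (app (Var 1) (Var 3)))
        (lam (app (app (app (app (Var 5) (Var 5)) (lam (lam (app (Var 0) (Var 6)))))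
          (Var 3)) (Var 2))))))))).

Definition min_prog (f : proc) : proc :=
  lam (lam (app (app (app (app (min_loop f) (min_loop f)) (num 0)) (Var 1)) (Var 0))).

Fixpoint compile (f : mu) : proc :=
  match f with
  | MZero => lam (lam (app (Var 0) (num 0)))
  | MSucc => succ_prog
  | MProj i => proj_prog i
  | MComp f gs => comp_prog (compile f) (vec_prog (map compile gs))
  | MPrim f g => prim_prog (compile f) (compile g)
  | MMin f => min_prog (compile f)
  end.

(** * Closedness of the compiled programs *)

Lemma cl_proj i : cl 0 (proj_prog i).
Proof. induction i; simpl; clt. Qed.
Hint Resolve cl_proj : clo.

Lemma cl_vec_prog ts : Forall (cl 0) ts -> cl 0 (vec_prog ts).
Proof. induction 1; simpl; clt. Qed.

Lemma cl_prim_loop f g : cl 0 f -> cl 0 g -> cl 0 (prim_loop f g).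
Proof. intros. unfold prim_loop. clt. Qed.
Hint Resolve cl_prim_loop : clo.

Lemma cl_min_loop f : cl 0 f -> cl 0 (min_loop f).
Proof. intros. unfold min_loop. clt. Qed.
Hint Resolve cl_min_loop : clo.

Lemma cl_compile : forall f, cl 0 (compile f).
Proof.
  fix IH 1. intros [| |i|f gs|f g|f]; simpl.
  - clt.
  - unfold succ_prog; clt.
  - clt.
  - assert (Hf := IH f).
    assert (Hgs : cl 0 (vec_prog (map compile gs))).
    { apply cl_vec_prog. revert gs. fix IHgs 1. intros [|g gs]; simpl.
      - constructor.
      - constructor; [apply IH | apply IHgs]. }
    unfold comp_prog; clt.
  - assert (Hf := IH f). assert (Hg := IH g). unfold prim_prog; clt.
  - assert (Hf := IH f). unfold min_prog; clt.
Qed.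
Hint Resolve cl_compile : clo.

Lemma cl_vec_compile gs : cl 0 (vec_prog (map compile gs)).
Proof.
  apply cl_vec_prog, Forall_map, Forall_forall. intros; apply cl_compile.
Qed.
Hint Resolve cl_vec_compile : clo.

(** Continuations are closed so that substitution leaves them unchanged while the program runs. *)
Definition computes (t : proc) (v : list nat) (r : proc) : Prop :=
  forall k s, cl 0 k -> reds k (r :: s) t (vec v :: k :: s).

Lemma succ_prog_run x v : computes succ_prog (x :: v) (num (S x)).
Proof. intros k s Hk. unfold succ_prog. simpl. run. apply reds_refl. Qed.

Lemma proj_prog_run i v : i < length v -> computes (proj_prog i) v (num (nth i v 0)).
Proof.
  revert v; induction i; intros [|x v] H k s Hk; simpl in *; try lia.
  - run. apply reds_refl.
  - run. apply IHi; auto. lia.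
Qed.

Lemma comp_prog_run f g v ws y :
  cl 0 f -> cl 0 g ->
  computes g v (vec ws) -> computes f ws (num y) -> computes (comp_prog f g) v (num y).
Proof.
  intros Hf Hg Eg Ef k s Hk. unfold comp_prog. run.
  eapply reds_trans; [apply Eg; clt|]. run. apply Ef; auto.
Qed.

Lemma vec_prog_cons_run t ts v w ws :
  cl 0 t -> cl 0 (vec_prog ts) ->
  computes t v (num w) -> computes (vec_prog ts) v (vec ws) ->
  computes (vec_prog (t :: ts)) v (vec (w :: ws)).
Proof.
  intros Ht Hts Et Ets k s Hk. simpl. run.
  eapply reds_trans; [apply Et; clt|]. run.
  eapply reds_trans; [apply Ets; clt|]. run. apply reds_refl.
Qed.

Definition loop_computes (f g : proc) (n : nat) (v : list nat) (r : proc) : Prop :=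
  forall k s, cl 0 k ->
    reds k (r :: s) (prim_loop f g) (prim_loop f g :: num n :: vec v :: k :: s).

Lemma prim_loop_0 f g v y :
  cl 0 f -> cl 0 g -> computes f v (num y) -> loop_computes f g 0 v (num y).
Proof.
  intros Hf Hg Ef k s Hk. unfold prim_loop at 1. simpl. run. apply Ef; auto.
Qed.

Lemma prim_loop_S f g n v z y :
  cl 0 f -> cl 0 g -> loop_computes f g n v (num z) ->
  computes g (n :: z :: v) (num y) -> loop_computes f g (S n) v (num y).
Proof.
  intros Hf Hg Ef Eg k s Hk. unfold prim_loop at 1. simpl. run.
  eapply reds_trans; [apply Ef; clt|]. run. apply Eg; auto.
Qed.

(** Induction on the distance [j] from the counter to the zero, with the counter [n] generalised
    since it grows at each round. *)
Lemma min_loop_run f n v j :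
  cl 0 f -> computes f (j + n :: v) (num 0) ->
  (forall m, n <= m < j + n -> exists k, computes f (m :: v) (num (S k))) ->
  forall k s, cl 0 k ->
    reds k (num (j + n) :: s) (min_loop f) (min_loop f :: num n :: vec v :: k :: s).
Proof.
  intros Hf. revert n. induction j; intros n E0 ES k s Hk; unfold min_loop at 1.
  - run. eapply reds_trans; [apply E0; clt|]. simpl. run. apply reds_refl.
  - replace (S j + n) with (j + S n) in * by lia. run. destruct (ES n) as (y & Ey); [lia|].
    eapply reds_trans; [apply Ey; clt|]. simpl. run.
    apply (IHj (S n)); auto. intros m Hm. apply ES. lia.
Qed.

Lemma prim_prog_run f g n v y :
  cl 0 f -> cl 0 g -> loop_computes f g n v (num y) ->
  computes (prim_prog f g) (n :: v) (num y).
Proof.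
  intros Hf Hg E k s Hk. unfold prim_prog. simpl. run. apply E; auto.
Qed.

Lemma min_prog_run f n v :
  cl 0 f -> computes f (n :: v) (num 0) ->
  (forall m, m < n -> exists k, computes f (m :: v) (num (S k))) ->
  computes (min_prog f) v (num n).
Proof.
  intros Hf E0 ES k s Hk. unfold min_prog. run.
  rewrite <- (Nat.add_0_r n) in *.
  apply (min_loop_run f 0 v n); auto. intros m Hm. apply ES. lia.
Qed.

(* In the successor case of primitive recursion, the induction hypothesis is
   needed for the loop rather than for the whole program. *)
Definition runs (f : mu) (v : list nat) (y : nat) : Prop :=
  match f, v with
  | MPrim f g, n :: v => loop_computes (compile f) (compile g) n v (num y)
  | _, _ => computes (compile f) v (num y)
  end.

Lemma runs_computes f v y : runs f v y -> computes (compile f) v (num y).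
Proof.
  destruct f, v; simpl; auto. intros H. apply prim_prog_run; try clt; auto.
Qed.

(** A mutual recursion on the derivations themselves, because the premise of [ev_min] keeps its
    derivations under an existential. *)
Lemma eval_runs f v y (e : eval f v y) : runs f v y
with evals_computes gs v ws (e : evals gs v ws) :
  computes (vec_prog (map compile gs)) v (vec ws).
Proof.
  - destruct e as [v|x v|i v Hi|f gs v ws y Es Ef|f g v y Ef|f g n v z y Ef Eg|f v n E0 ES].
    + intros k s Hk. simpl. run. apply reds_refl.
    + apply succ_prog_run.
    + apply proj_prog_run, Hi.
    + apply comp_prog_run with ws; try clt.
      * apply evals_computes, Es.
      * apply runs_computes, eval_runs, Ef.
    + apply prim_loop_0; try clt. apply runs_computes, eval_runs, Ef.
    + apply prim_loop_S with z; try clt.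
      * apply eval_runs in Ef. exact Ef.
      * apply runs_computes, eval_runs, Eg.
    + apply min_prog_run; try clt.
      * apply runs_computes, eval_runs, E0.
      * intros m Hm. destruct (ES m Hm) as (k & Ek). exists k.
        apply runs_computes, eval_runs, Ek.
  - destruct e as [v|g gs v w ws Eg Es].
    + intros k s Hk. simpl. run. apply reds_refl.
    + apply vec_prog_cons_run; try clt.
      * apply runs_computes, eval_runs, Eg.
      * apply evals_computes, Es.
Qed.

(** * Arithmetisation and diagonalisation *)

Lemma eval_comp1 f g v x y :
  eval g v x -> eval f [x] y -> eval (MComp f [g]) v y.
Proof. intros Hg Hf. eapply ev_comp; [|exact Hf]. repeat constructor; auto. Qed.

Lemma eval_comp2 f g1 g2 v x1 x2 y :
  eval g1 v x1 -> eval g2 v x2 -> eval f [x1; x2] y ->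
  eval (MComp f [g1; g2]) v y.
Proof. intros H1 H2 Hf. eapply ev_comp; [|exact Hf]. repeat constructor; auto. Qed.

Lemma eval_proj i v : i < length v -> forall y, y = nth i v 0 -> eval (MProj i) v y.
Proof. intros H y ->. apply ev_proj, H. Qed.

Definition mu_succ (m : mu) : mu := MComp MSucc [m].

Lemma eval_succ m v x : eval m v x -> eval (mu_succ m) v (S x).
Proof. intros H. eapply eval_comp1; [exact H|]. constructor. Qed.

Fixpoint mu_const (n : nat) : mu :=
  match n with 0 => MZero | S n => mu_succ (mu_const n) end.

Lemma eval_const n v : eval (mu_const n) v n.
Proof. induction n; simpl; [constructor | apply eval_succ, IHn]. Qed.

Definition mu_add : mu := MPrim (MProj 0) (mu_succ (MProj 1)).

Lemma eval_add x y : eval mu_add [x; y] (x + y).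
Proof.
  induction x; simpl.
  - apply ev_prim0, eval_proj; simpl; auto.
  - eapply ev_primS; [exact IHx|]. apply eval_succ, eval_proj; simpl; auto; lia.
Qed.

(** The part of the Cantor pairing that divides: [pair x y] is [triangle (x + y) + y]. Its
    recurrence turns the division into primitive recursion. *)
Definition triangle (n : nat) : nat := n * (n + 1) / 2.

Lemma triangle_S n : triangle (S n) = triangle n + S n.
Proof.
  unfold triangle. replace (S n * (S n + 1)) with (n * (n + 1) + S n * 2) by lia.
  apply Nat.div_add. lia.
Qed.

Definition mu_triangle : mu :=
  MPrim MZero (MComp mu_add [MProj 1; mu_succ (MProj 0)]).

Lemma eval_triangle n : eval mu_triangle [n] (triangle n).
Proof.
  induction n.
  - apply ev_prim0, ev_zero.
  - rewrite triangle_S. eapply ev_primS; [exact IHn|].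
    eapply eval_comp2; [| |apply eval_add].
    + apply eval_proj; simpl; auto; lia.
    + apply eval_succ, eval_proj; simpl; auto; lia.
Qed.

Definition mu_pair (m1 m2 : mu) : mu :=
  MComp mu_add [MComp mu_triangle [MComp mu_add [m1; m2]]; m2].

Lemma eval_pair m1 m2 v x y :
  eval m1 v x -> eval m2 v y -> eval (mu_pair m1 m2) v (pair x y).
Proof.
  intros H1 H2. change (pair x y) with (triangle (x + y) + y).
  eapply eval_comp2; [|exact H2|apply eval_add].
  eapply eval_comp1; [|apply eval_triangle].
  eapply eval_comp2; eauto using eval_add.
Qed.

Definition mu_inp (a : nat) (m : mu) : mu :=
  mu_succ (mu_pair (mu_const 1) (mu_pair (mu_const a) m)).
Definition mu_out (a : nat) (m : mu) : mu :=
  mu_succ (mu_pair (mu_const 2) (mu_pair (mu_const a) m)).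
Definition mu_par (m1 m2 : mu) : mu :=
  mu_succ (mu_pair (mu_const 3) (mu_pair m1 m2)).

Lemma eval_inp a m v P : eval m v (enc P) -> eval (mu_inp a m) v (enc (Inp a P)).
Proof. intros H. cbn [enc]. apply eval_succ; auto using eval_pair, eval_const. Qed.

Lemma eval_out a m v P : eval m v (enc P) -> eval (mu_out a m) v (enc (Out a P)).
Proof. intros H. cbn [enc]. apply eval_succ; auto using eval_pair, eval_const. Qed.

Lemma eval_par m1 m2 v P Q :
  eval m1 v (enc P) -> eval m2 v (enc Q) -> eval (mu_par m1 m2) v (enc (Par P Q)).
Proof. intros H1 H2. cbn [enc]. apply eval_succ; auto using eval_pair, eval_const. Qed.

Definition mu_enc (P : proc) : mu := mu_const (enc P).

Lemma eval_enc P v : eval (mu_enc P) v (enc P).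
Proof. apply eval_const. Qed.

Transparent lam app.

(** Writes a numeral out as a process, so that its encoding becomes a primitive recursion on [n];
    the lifts vanish as [num n] is closed. *)
Lemma num_S n :
  num (S n) =
  Inp 1 (Par (Var 0) (Inp 0 (Inp 1 (Par (Var 0) (Inp 0 (Inp 1
    (Par (Var 1) (Out 1 (Par (Out 0 (num n)) (Out 1 (Var 0))))))))))).
Proof.
  simpl. unfold app, lam. simpl.
  rewrite !(fun c => lift_cl 0 c (num n) (cl_num n) (Nat.le_0_l c)). reflexivity.
Qed.

Opaque lam app.

Definition mu_num_step (m : mu) : mu :=
  mu_inp 1 (mu_par (mu_enc (Var 0)) (mu_inp 0 (mu_inp 1
    (mu_par (mu_enc (Var 0)) (mu_inp 0 (mu_inp 1 (mu_par (mu_enc (Var 1))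
      (mu_out 1 (mu_par (mu_out 0 m) (mu_enc (Out 1 (Var 0)))))))))))).

Definition mu_num : mu := MPrim (mu_enc (num 0)) (mu_num_step (MProj 1)).

Lemma eval_num n : eval mu_num [n] (enc (num n)).
Proof.
  induction n.
  - apply ev_prim0, eval_enc.
  - eapply ev_primS; [exact IHn|]. rewrite num_S. unfold mu_num_step.
    repeat first [ apply eval_enc | apply eval_inp | apply eval_out | apply eval_par ].
    apply eval_proj; simpl; auto; lia.
Qed.

(** * The self-referential systems *)

Definition initial (code : proc) (n : nat) (bottom : proc) : proc :=
  Par code (Out 1 (stack [num n] bottom)).

(** The diagonal map: its single argument is used both as the encoding of the code and as the number
    whose numeral is put on the stack. *)
Definition mu_initial (bottom : proc) : mu :=
  mu_par (MProj 0)
    (mu_out 1 (mu_par (mu_out 0 mu_num) (mu_enc (Out 1 bottom)))).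

Lemma eval_initial code bottom :
  eval (mu_initial bottom) [enc code] (enc (initial code (enc code) bottom)).
Proof.
  unfold mu_initial, initial, stack.
  repeat first [ apply eval_enc | apply eval_out | apply eval_par ].
  - apply eval_proj; simpl; auto.
  - apply eval_num.
Qed.

(** Receives the stack and runs it, which on an empty stack releases the bottom. *)
Definition pop : proc := Inp 1 (Var 0).

(** Packs its argument [x] into the vector of [[x]], runs [f], and branches on the answer: 0 leads
    to [Nil], a positive answer drops its predecessor and leads to [pop]. *)
Definition test_code (f : mu) : proc :=
  lam (app (app (compile f) (lam (app (app (Var 0) (Var 1)) Nil)))
           (lam (app (app (Var 0) Nil) (lam pop)))).

Lemma test_code_run f x y :
  y < 2 -> eval f [x] y ->
  reds (match y with 0 => Nil | _ => pop end) [] (test_code f) [num x].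
Proof.
  intros Hy He. apply eval_runs, runs_computes in He. unfold test_code.
  assert (Hp : cl 0 pop) by (simpl; lia).
  run. eapply reds_trans; [apply He; clt|].
  run. destruct y as [|[|y]]; [| |lia]; simpl; run; apply reds_refl.
Qed.

Lemma initial_equiv code n :
  reds Nil [] code [num n] ->
  strong_barbed_equiv [0; 1] (initial code n (Out 2 Nil)) (initial code n Nil).
Proof.
  intros HR. apply lockstep_equiv. apply (lockstep_reds _ _ _ _ _ _ HR).
  apply lock_stuck; try (intros x [<-|[]]; simpl; auto).
  (* A communication needs two components, and only the output of the stack is left. *)
  all: intros L (m & R & B & K & H & _); apply Permutation_length in H; discriminate.
Qed.

Lemma det_pop b : det (conf pop [] b) (flat b).
Proof.
  pose proof (det_com 1 b (Var 0) []) as D. rewrite app_nil_r in D.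
  apply (det_perm _ (conf pop [] b)) in D; [exact D | apply perm_swap | intros x []].
Qed.

(** Following the deterministic runs, a bisimulation would relate the two released bottoms, but only
    [Out 2 Nil] has a barb, on the visible name 2. *)
Lemma initial_not_equiv code n :
  reds pop [] code [num n] ->
  ~ strong_barbed_equiv [0; 1] (initial code n (Out 2 Nil)) (initial code n Nil).
Proof.
  intros HR (Rel & HB & HPQ).
  destruct (bisim_reds _ _ _ _ _ _ (Out 2 Nil) Nil _ _ HB HR HPQ)
    as (P' & Q' & HPQ' & HP' & HQ'); try reflexivity.
  destruct (bisim_det _ _ _ _ _ _ HB HPQ'
              (det_perm _ _ _ (Permutation_sym HP') (det_pop _))
              (det_perm _ _ _ (Permutation_sym HQ') (det_pop _)))
    as (P & Q & HPQ2 & HP & HQ).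
  destruct HB as [_ HB]. destruct (HB _ _ HPQ2) as [Hbarb _].
  destruct (out_step P 2 Nil) as (P2 & HP2); [rewrite HP; simpl; auto|].
  destruct (Hbarb 2 true) as (_ & R & Q2 & HQ2).
  { split; [simpl; lia | eauto]. }
  apply step_flat in HQ2. rewrite HQ in HQ2.
  apply Permutation_length in HQ2. discriminate.
Qed.

Theorem theorem3p3 :
  exists a b : nat, a <> b /\ ~ exists M : mu, decides_sbe [a; b] M.
Proof.
  exists 0, 1. split; [discriminate|]. intros (M & HM).
  (* On the encoding of any code, [D] returns the answer of [M] about that code started on its own
     encoding with the two bottoms. *)
  pose (D := MComp M [mu_initial (Out 2 Nil); mu_initial Nil]).
  pose (code := test_code D).
  assert (HD : forall y,
    eval M [enc (initial code (enc code) (Out 2 Nil));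
            enc (initial code (enc code) Nil)] y -> eval D [enc code] y).
  { intros y. apply eval_comp2; apply eval_initial. }
  destruct (HM (initial code (enc code) (Out 2 Nil)) (initial code (enc code) Nil))
    as [Heq Hneq].
  (* If they were equivalent, [M] would answer 1, and the code would reach [pop] and tell the
     bottoms apart. *)
  assert (Hne : ~ strong_barbed_equiv [0; 1]
    (initial code (enc code) (Out 2 Nil)) (initial code (enc code) Nil)).
  { intros E. refine (initial_not_equiv _ _ _ E).
    apply (test_code_run D _ 1); auto. }
  (* Hence [M] answers 0, so the code gets stuck at [Nil] and the systems are equivalent after
     all. *)
  apply Hne, initial_equiv, (test_code_run D _ 0); auto.
Qed.
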